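(* Let $n\geq 3$ be an integer, and let $P_n$ and $C_n$ denote the path and the cycle on $n$ vertices. Then $\chi^d_i(P_n)=2$ and $\chi^d_i(C_n)=2$ for every integer $d\geq 1$.
   Context: All graphs are simple. For a graph $G$, an incidence is a pair $(v,e)$ with $v\in V(G)$ an endpoint of the edge $e\in E(G)$; $I(G)$ is the set of all incidences. For $u\in V(G)$ and a neighbor $v$ of $u$, $(u,uv)$ is a strong incidence of $u$ and $(v,uv)$ is a weak incidence of $u$; $I_u$ and $A_u$ denote the sets of strong and weak incidences of $u$. For a map $\varphi$ on $I(G)$, $\varphi(I_u)=\{\varphi(u,uv): v\in N_G(u)\}$. Let $[k]=\{1,\dots,k\}$. A $d$-defective incidence $k$-coloring of $G$ is a map $\varphi: I(G)\to[k]$ such that for every $u\in V(G)$: (a) $\varphi(u,uv)\neq\varphi(u,uw)$ for distinct $v,w\in N_G(u)$; (b) $\varphi(u,uv)\neq\varphi(v,uv)$ for every $v\in N_G(u)$; (c) every color in $\varphi(I_u)$ appears at most $d$ times among the incidences of $A_u$. The $d$-defective incidence chromatic number $\chi^d_i(G)$ is the minimum $k$ such that $G$ has a $d$-defective incidence $k$-coloring. *)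

(* Defs.v *)
From HB Require Import structures.
From mathcomp Require Import all_boot.
From mathcomp Require Import boolp.

Set Implicit Arguments.
Unset Strict Implicit.
Unset Printing Implicit Defensive.

Record sgraph := SGraph {
  vertex :> finType;
  adj : rel vertex;
  adj_sym : symmetric adj;
  adj_irrefl : irreflexive adj }.

Section Incidences.
Variable G : sgraph.

Definition edges : {set {set G}} :=
  [set e | [exists u : G, exists v : G, adj u v && (e == [set u; v])]].

Definition incident (p : G * {set G}) : bool :=
  (p.2 \in edges) && (p.1 \in p.2).

Definition incidence := {p : G * {set G} | incident p}.

Lemma strong_incP (u v : G) : adj u v -> incident (u, [set u; v]).
Proof.
move=> uv; rewrite /incident /= !inE eqxx andbT.
by apply/existsP; exists u; apply/existsP; exists v; rewrite uv eqxx.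
Qed.

Lemma weak_incP (u v : G) : adj u v -> incident (v, [set u; v]).
Proof.
move=> uv; rewrite /incident /= !inE eqxx orbT andbT.
by apply/existsP; exists u; apply/existsP; exists v; rewrite uv eqxx.
Qed.

(* strong_inc uv is (u, uv) and weak_inc uv is (v, uv). *)
Definition strong_inc (u v : G) (uv : adj u v) : incidence :=
  exist _ (u, [set u; v]) (strong_incP uv).

Definition weak_inc (u v : G) (uv : adj u v) : incidence :=
  exist _ (v, [set u; v]) (weak_incP uv).

(* The sets I_u and A_u. *)
Definition strong_incs (u : G) : {set incidence} :=
  [set x | [exists v : G, adj u v && (val x == (u, [set u; v]))]].

Definition weak_incs (u : G) : {set incidence} :=
  [set x | [exists v : G, adj u v && (val x == (v, [set u; v]))]].

Definition defective_incidence_coloring (d k : nat)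
    (phi : incidence -> 'I_k) : Prop :=
  forall u : G,
  [/\ forall (v w : G) (uv : adj u v) (uw : adj u w),
        v <> w -> phi (strong_inc uv) <> phi (strong_inc uw),
      forall (v : G) (uv : adj u v),
        phi (strong_inc uv) <> phi (weak_inc uv)
    & forall c : 'I_k, c \in [set phi x | x in strong_incs u] ->
        #|[set x in weak_incs u | phi x == c]| <= d].

Definition defective_incidence_colorable (d k : nat) : Prop :=
  exists phi : incidence -> 'I_k, defective_incidence_coloring d phi.

(* Giving every incidence its own color works even for d = 0, so the minimum
   below ranges over a nonempty set. *)
Lemma defective_incidence_colorable_ex (d : nat) :
  exists k, `[< defective_incidence_colorable d k >].
Proof.
exists #|{: incidence}|; apply/asboolP.
exists (fun x => enum_rank x) => u; split.
- move=> v w uv uw vw /enum_rank_inj /(congr1 val) /= [] /setP E.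
  have := E v; rewrite !inE eqxx orbT => /esym /orP[] /eqP // Ev.
  by move: uv; rewrite Ev adj_irrefl.
- move=> v uv /enum_rank_inj /(congr1 val) /= [] Ev.
  by move: uv; rewrite Ev adj_irrefl.
- move=> c /imsetP[x]; rewrite inE => /existsP[v /andP[uv /eqP xE]] ->.
  rewrite (_ : [set _ in _ | _] = set0) ?cards0 //.
  apply/setP=> y; rewrite !inE; apply/negP=> /andP[/existsP[w /andP[uw /eqP yE]]].
  move=> /eqP /enum_rank_inj yx; move: yE; rewrite yx xE => -[Ew _].
  by move: uw; rewrite Ew adj_irrefl.
Qed.

Definition defective_incidence_chi (d : nat) : nat :=
  ex_minn (defective_incidence_colorable_ex d).

End Incidences.

Section PathCycle.
Variable n : nat.

Definition path_adj : rel 'I_n :=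
  fun i j => (i.+1 == j :> nat) || (j.+1 == i :> nat).

Lemma path_adj_sym : symmetric path_adj.
Proof. by move=> i j; rewrite /path_adj orbC. Qed.

Lemma path_adj_irrefl : irreflexive path_adj.
Proof. by move=> i; rewrite /path_adj -{2 4}[val i]/(i : nat) gtn_eqF. Qed.

Definition path_graph : sgraph := SGraph path_adj_sym path_adj_irrefl.

(* The guard i != j only matters for n = 1, where it removes the loop. *)
Definition cycle_adj : rel 'I_n :=
  fun i j => (i != j) && ((i.+1 %% n == j) || (j.+1 %% n == i)).

Lemma cycle_adj_sym : symmetric cycle_adj.
Proof. by move=> i j; rewrite /cycle_adj eq_sym orbC. Qed.

Lemma cycle_adj_irrefl : irreflexive cycle_adj.
Proof. by move=> i; rewrite /cycle_adj eqxx. Qed.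

Definition cycle_graph : sgraph := SGraph cycle_adj_sym cycle_adj_irrefl.

End PathCycle.

(* Main.v *)
Require Import Defs.
From mathcomp Require Import all_boot.
From mathcomp Require Import boolp zify.

Set Implicit Arguments.
Unset Strict Implicit.
Unset Printing Implicit Defensive.

(** Orient the path or cycle so that every vertex has at most one out-neighbor
    and at most one in-neighbor, and color the incidence [(u, uv)] by whether
    the edge [uv] leaves or enters [u].  The two strong incidences of a vertex
    then get different colors, the two incidences of an edge get different
    colors, and each color occurs at most once among the weak incidences of a
    vertex.  One color is not enough as soon as there is an edge. *)

Section Orientation.
Variables (G : sgraph) (arc : rel G).
Hypothesis adj_arc : forall u v : G, adj u v = arc u v || arc v u.
Hypothesis arc_asym : forall u v : G, arc u v -> ~~ arc v u.
Hypothesis arc_out : forall u v w : G, arc u v -> arc u w -> v = w.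
Hypothesis arc_in : forall u v w : G, arc v u -> arc w u -> v = w.

(** An incidence stores its edge as an unordered set; since [arc] is irreflexive, the only possible
    witness in that set is the other endpoint. *)
Definition leaves (p : G * {set G}) : bool := [exists v in p.2, arc p.1 v].

Definition arc_coloring (x : incidence G) : 'I_2 :=
  if leaves (val x) then ord0 else ord_max.

Lemma arc_irrefl (u : G) : arc u u = false.
Proof. by apply/negP => uu; have := arc_asym uu; rewrite uu. Qed.

Lemma leaves_fst (u v : G) : leaves (u, [set u; v]) = arc u v.
Proof.
apply/exists_inP/idP => [[w /=]|uv]; last by exists v; rewrite // !inE eqxx orbT.
by rewrite !inE => /orP[]/eqP-> //; rewrite arc_irrefl.
Qed.

Lemma leaves_snd (u v : G) : leaves (v, [set u; v]) = arc v u.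
Proof. by rewrite setUC leaves_fst. Qed.

Lemma arc_coloring_eq (x y : incidence G) :
  (arc_coloring x == arc_coloring y) = (leaves (val x) == leaves (val y)).
Proof. by rewrite /arc_coloring; do 2 case: leaves. Qed.

Lemma arc_flip (u v : G) : adj u v -> arc v u = ~~ arc u v.
Proof.
rewrite adj_arc; case uv: (arc u v) => /=; last by [].
by move=> _; apply/negbTE/arc_asym.
Qed.

Lemma arc_eq_neighbor (u v w : G) :
  adj u v -> adj u w -> arc u v = arc u w -> v = w.
Proof.
move=> uv uw; case Euv: (arc u v) => Euw; first exact: arc_out Euv (esym Euw).
(* Neither edge leaves [u], so both enter it. *)
by apply: (@arc_in u); rewrite arc_flip // ?Euv // -Euw.
Qed.

Lemma arc_coloringP (d : nat) :
  0 < d -> defective_incidence_coloring d arc_coloring.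
Proof.
move=> d_gt0 u; split.
- move=> v w uv uw vw /eqP; rewrite arc_coloring_eq /= !leaves_fst => /eqP E.
  exact: vw (arc_eq_neighbor uv uw E).
- move=> v uv /eqP; rewrite arc_coloring_eq /= leaves_fst leaves_snd (arc_flip uv).
  by case: (arc u v).
(* The color of a weak incidence at [u] also tells the direction of its edge, so two of equal color
   come from the same neighbor. *)
- move=> c _; apply: leq_trans d_gt0; apply/card_le1_eqP => x y.
  rewrite !inE => /andP[/existsP[v /andP[uv /eqP xE]] /eqP cx].
  move=> /andP[/existsP[w /andP[uw /eqP yE]] /eqP cy].
  have /eqP: arc_coloring x = arc_coloring y by rewrite cx cy.
  rewrite arc_coloring_eq xE yE !leaves_snd (arc_flip uv) (arc_flip uw) => /eqP/negb_inj vw.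
  by apply: val_inj; rewrite /= xE yE (arc_eq_neighbor uv uw vw).
Qed.

End Orientation.

(** Condition (b) separates the two incidences of the edge, while ['I_0] is empty and ['I_1] has a
    single element. *)
Lemma colorable_gt1 (G : sgraph) (u v : G) (d k : nat) :
  adj u v -> defective_incidence_colorable G d k -> 1 < k.
Proof.
move=> uv [phi /(_ u)[_ /(_ v uv) neq _]].
case: k phi neq => [|[|//]] phi; first by case: (phi (strong_inc uv)).
by rewrite !ord1.
Qed.

Lemma chi_oriented (G : sgraph) (arc : rel G) (u v : G) (d : nat) :
    (forall x y : G, adj x y = arc x y || arc y x) ->
    (forall x y : G, arc x y -> ~~ arc y x) ->
    (forall x y z : G, arc x y -> arc x z -> y = z) ->
    (forall x y z : G, arc y x -> arc z x -> y = z) ->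
  adj u v -> 0 < d -> defective_incidence_chi G d = 2.
Proof.
move=> adjE asym out inn uv d_gt0; rewrite /defective_incidence_chi.
case: ex_minnP => k /asboolP colk mink; apply/eqP; rewrite eqn_leq.
rewrite (colorable_gt1 uv colk) andbT; apply/mink/asboolP.
by exists (arc_coloring arc); apply: arc_coloringP.
Qed.

(** Trades the modulus for a case split, leaving linear goals for [lia]. *)
Lemma modSn_ord (n : nat) (i : 'I_n) :
  i.+1 %% n = if i.+1 == n then 0 else i.+1.
Proof.
case: eqP => [->|neq]; first exact: modnn.
by rewrite modn_small //; have := ltn_ord i; lia.
Qed.

Theorem theorem1 (n : nat) (hn : 3 <= n) (d : nat) (hd : 1 <= d) :
  defective_incidence_chi (path_graph n) d = 2 /\
  defective_incidence_chi (cycle_graph n) d = 2.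
Proof.
have n_gt0 : 0 < n by lia.
have n_gt1 : 1 < n by lia.
split.
- apply: (@chi_oriented (path_graph n) (fun i j : 'I_n => i.+1 == j)
    (Ordinal n_gt0) (Ordinal n_gt1)) => //= i j; [lia | |];
    by move=> k ? ?; apply: val_inj => /=; lia.
- apply: (@chi_oriented (cycle_graph n) (fun i j : 'I_n => i.+1 %% n == j)
    (Ordinal n_gt0) (Ordinal n_gt1)) => //=.
  (* The guard [i != j] follows from either arc, as [n > 1]. *)
  + move=> i j; rewrite /cycle_adj -val_eqE /= !modSn_ord.
    by have := ltn_ord i; have := ltn_ord j; case: (i.+1 =P n); case: (j.+1 =P n); lia.
  (* Here [3 <= n] is essential: for [n = 2] the arcs 0 to 1 and 1 to 0 would both exist. *)
  + move=> i j; rewrite !modSn_ord.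
    by have := ltn_ord i; have := ltn_ord j; case: (i.+1 =P n); case: (j.+1 =P n); lia.
  + by move=> i j k /eqP ij /eqP ik; apply: val_inj; rewrite /= -ij -ik.
  (* The cyclic successor is injective: 0 is reached only from [n - 1]. *)
  + move=> i j k; rewrite !modSn_ord => ji ki; apply: val_inj => /=.
    move: ji ki; have := ltn_ord j; have := ltn_ord k.
    by case: (j.+1 =P n); case: (k.+1 =P n); lia.
  + by rewrite /cycle_adj /= modn_small.
Qed.
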